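(* Let $\{P_m\}_{m\ge 0}$ be the Padovan sequence. The pair $(n,x)=(4,5)$ is the only pair such that $n$ is a non-negative integer, $x$ is a Padovan number (that is, $x=P_m$ for some integer $m\ge 0$), and $n!+1=x^{2}$.
   Context: The Padovan sequence $\{P_m\}_{m\ge 0}$ is defined by $P_0=P_1=P_2=1$ and $P_{m+3}=P_{m+1}+P_m$ for all $m\ge 0$. Its first terms are $1,1,1,2,2,3,4,5,7,9,12,16,\ldots$. Uniqueness refers to the pair $(n,x)$, not to the index $m$. *)

(* Defs.v *)
From mathcomp Require Import all_boot.

Set Implicit Arguments.
Unset Strict Implicit.
Unset Printing Implicit Defensive.

Fixpoint padovan (m : nat) : nat :=
  match m with
  | (m'.+1 as m1).+2 => padovan m1 + padovan m'
  | _ => 1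
  end.

(* Main.v *)
(* A solution with n >= 21 makes x ^ 2 = 1 modulo 35 and modulo 7 ^ (n / 7). The
   Padovan sequence, extended to negative indices, has period dividing 48 modulo
   35, and its residues of square 1 modulo 35 occur exactly in the residue classes
   modulo 48 of the eleven indices z with P_z = 1 or P_z = -1, all of them in
   [-26, 2]. Each such zero of P_m - P_z is simple 7-adically: if m = z mod 48 and
   7 ^ (k + 1) divides P_m - P_z, then 48 * 7 ^ k divides m - z. Hence m grows
   exponentially with n, whereas P_m >= 2 ^ (m / 3) and n! < 2 ^ (n ^ 2) bound m by
   a quadratic function of n. *)
From Stdlib Require Import ZArith Znumtheory Zpow_facts Lia.
Require Import Defs.
From mathcomp Require Import all_boot.
From mathcomp Require Import zify.

Set Implicit Arguments.
Unset Strict Implicit.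
Unset Printing Implicit Defensive.

Local Open Scope nat_scope.

(** * Periods of Padovan-like sequences *)

Definition padovan_like (s : nat -> Z) : Prop :=
  forall i, s i.+3 = (s i.+1 + s i)%Z.

(** The quotient satisfies the same recurrence, so a divisibility valid for all such sequences can
    be applied to it a second time. *)
Lemma padovan_like_quotient (s : nat -> Z) (N : nat) (c : Z) :
  c <> 0%Z -> padovan_like s -> (forall i, (c | s (i + N)%N - s i)%Z) ->
  padovan_like (fun i => (s (i + N)%N - s i) / c)%Z.
Proof.
move=> c0 sP cN i.
have [u Hu] := cN i; have [v Hv] := cN i.+1; have [w Hw] := cN i.+3.
rewrite Hu Hv Hw !Z.div_mul //.
have := sP (i + N); have := sP i; rewrite !addSn in Hv Hw * => s1 s2.
by apply: (Z.mul_reg_r _ _ c) => //; lia.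
Qed.

Lemma period_mul (s : nat -> Z) (N : nat) (c : Z) :
  (forall i, (c | s (i + N)%N - s i)%Z) ->
  forall i j, (c | s (i + j * N)%N - s i)%Z.
Proof.
move=> cN i; elim=> [|j [v Hv]]; first by exists 0%Z; rewrite mul0n addn0; lia.
have [u Hu] := cN (i + j * N).
by exists (u + v)%Z; rewrite mulSn [N + _]addnC addnA; lia.
Qed.

(* The shift by N is 1 + c r for an operator r commuting with it; this is the
   expansion of its j-th power modulo c ^ 2. *)
Lemma period_second_order (N : nat) (c : Z) : c <> 0%Z ->
  (forall s, padovan_like s -> forall i, (c | s (i + N)%N - s i)%Z) ->
  forall s, padovan_like s -> forall i j,
  (c * c | s (i + j * N)%N - s i - Z.of_nat j * (s (i + N)%N - s i))%Z.
Proof.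
move=> c0 cN s sP i j.
have rE l : (s (l + N)%N - s l = c * ((s (l + N)%N - s l) / c))%Z.
  by have [u ->] := cN s sP l; rewrite Z.div_mul //; lia.
have rP := padovan_like_quotient c0 sP (cN s sP).
elim: j => [|j [v Hv]]; first by exists 0%Z; rewrite mul0n addn0; lia.
have [u Hu] := period_mul (cN _ rP) i j.
have e1 := rE (i + j * N); have e2 := rE i.
exists (u + v)%Z; rewrite mulSn [N + _]addnC addnA.
move: Hu e1 e2 Hv; set r1 := (_ / c)%Z; set r2 := (_ / c)%Z => Hu e1 e2 Hv.
have {}Hu : (c * r1 - c * r2 = u * (c * c))%Z.
  by rewrite -Z.mul_sub_distr_l Hu; ring.
by lia.
Qed.

Lemma padovan_like_period35 (s : nat -> Z) : padovan_like s ->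
  forall i, (35 | s (i + 48)%N - s i)%Z.
Proof.
move=> sP i.
(* The coefficients are those of X^24 modulo X^3 - X - 1. *)
have h l : (s (l + 24)%N = 200 * s l.+2 + 265 * s l.+1 + 151 * s l)%Z.
  rewrite -(addn0 l); do 22![rewrite ?addnS ?addn0]; rewrite ?addnS ?addn0.
  move: (sP l) (sP l.+1) (sP l.+2) (sP l.+3) (sP l.+4) (sP l.+4.+1)
    (sP l.+4.+2) (sP l.+4.+3) (sP l.+4.+4) (sP l.+4.+4.+1) (sP l.+4.+4.+2)
    (sP l.+4.+4.+3) (sP l.+4.+4.+4) (sP l.+4.+4.+4.+1) (sP l.+4.+4.+4.+2)
    (sP l.+4.+4.+4.+3) (sP l.+4.+4.+4.+4) (sP l.+4.+4.+4.+4.+1)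
    (sP l.+4.+4.+4.+4.+2) (sP l.+4.+4.+4.+4.+3) (sP l.+4.+4.+4.+4.+4)
    (sP l.+4.+4.+4.+4.+4.+1).
  by lia.
have := h (i + 24); rewrite -addnA -[(24 + 24)%N]/48 -!addSn !h => ->.
(* Squaring the reduction of X^24 gives X^48 - 1 = 35 (4875 X^2 + 6458 X + 3680) modulo X^3 - X -
   1. *)
exists (4875 * s i.+2 + 6458 * s i.+1 + 3680 * s i)%Z.
have := sP i; have := sP i.+1; lia.
Qed.

(** * The two-sided sequence modulo 35 *)

(* The two-sided Padovan sequence, read from index -26 on: index -26 is the
   smallest one at which it takes the value 1 or -1. *)
Definition padovan_shifted (i : nat) : Z :=
  (iter i (fun t => (t.1.2, t.2, t.1.1 + t.1.2)) (1, 10, -14)).1.1%Z.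

Lemma padovan_shifted_like : padovan_like padovan_shifted.
Proof. by move=> i; rewrite /padovan_shifted !iterS /= Z.add_comm. Qed.

Lemma padovan_shiftedE (m : nat) :
  padovan_shifted (26 + m) = Z.of_nat (padovan m).
Proof.
suff [] : padovan_shifted (26 + m) = Z.of_nat (padovan m) /\
  padovan_shifted (26 + m.+1) = Z.of_nat (padovan m.+1) /\
  padovan_shifted (26 + m.+2) = Z.of_nat (padovan m.+2) by [].
elim: m => [|m [e0 [e1 e2]]]; first by [].
split=> //; split=> //; rewrite !addnS padovan_shifted_like -!addnS e0 e1.
by rewrite -Nat2Z.inj_add.
Qed.

(** The eleven indices z with P_z = 1 or P_z = -1, shifted by 26. *)
Definition unit_indices : seq nat :=
  [:: 0; 13; 14; 17; 19; 20; 21; 24; 26; 27; 28].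

Lemma padovan_shifted_sieve (i : nat) :
  (35 | padovan_shifted i * padovan_shifted i - 1)%Z ->
  i %% 48 \in unit_indices.
Proof.
have P := period_mul (padovan_like_period35 padovan_shifted_like).
have [v Hv] := P (i %% 48) (i %/ 48).
rewrite addnC -divn_eq in Hv.
have check : all (fun k => ((padovan_shifted k * padovan_shifted k - 1) mod 35 =? 0)%Z
    ==> (k \in unit_indices)) (iota 0 48) by vm_compute.
move=> [u Hu]; have /allP/(_ (i %% 48)) := check.
rewrite mem_iota ltn_mod => /(_ isT)/implyP; apply.
move: (padovan_shifted i) (padovan_shifted (i %% 48)) Hu Hv => a b Hu Hv.
apply/Z.eqb_eq; apply: (proj2 (Z.mod_divide _ 35 _)); first by [].
exists (u - v * (a + b))%Z.
have -> : (b * b - 1 = (a * a - 1) - (a - b) * (a + b))%Z by ring.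
by rewrite Hu Hv; ring.
Qed.

(** * 7-adic lifting *)

Lemma pow7S (k : nat) :
  (7 ^ Z.of_nat k.+1 = 7 * 7 ^ Z.of_nat k)%Z.
Proof. by rewrite Nat2Z.inj_succ Z.pow_succ_r //; apply: Nat2Z.is_nonneg. Qed.

Lemma padovan_like_period7 (k : nat) (s : nat -> Z) : padovan_like s ->
  forall i, (7 ^ Z.of_nat k.+1 | s (i + 48 * 7 ^ k)%N - s i)%Z.
Proof.
elim: k s => [|k IHk] s sP i.
  have [u Hu] := padovan_like_period35 sP i.
  by exists (5 * u)%Z; rewrite muln1 Hu; change (7 ^ Z.of_nat 1)%Z with 7%Z; ring.
have c0 : (7 ^ Z.of_nat k.+1 <> 0)%Z by apply: Z.pow_nonzero; lia.
(* Modulo c ^ 2, seven shifts multiply the one-shift difference by 7, which gains one factor 7. *)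
have [u Hu] := period_second_order c0 IHk sP i 7.
have [v Hv] := IHk _ sP i.
rewrite expnS mulnCA pow7S; exists (u * 7 ^ Z.of_nat k + v)%Z.
rewrite Hv in Hu; apply/(Z.sub_cancel_r _ _ (7 * (v * 7 ^ Z.of_nat k.+1))).
by rewrite Hu pow7S; ring.
Qed.

(* The second-order error term 7 ^ (2 k + 2) is negligible modulo 7 ^ (k + 3) only
   for k >= 1, so the induction starts from k = 1 and k = 0 is checked apart. *)
Lemma padovan_shifted_valuation (k z : nat) : z \in unit_indices ->
  ~ (7 ^ Z.of_nat k.+2 |
     padovan_shifted (z + 48 * 7 ^ k)%N - padovan_shifted z)%Z.
Proof.
move=> zI.
have base l : l = 0 \/ l = 1 -> ~ (7 ^ Z.of_nat l.+2 |
     padovan_shifted (z + 48 * 7 ^ l)%N - padovan_shifted z)%Z.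
  have /allP/(_ z zI)/andP[/eqP h0 /eqP h1] : all (fun t =>
    (((padovan_shifted (t + 48) - padovan_shifted t) mod 7 ^ 2 =? 0)%Z == false)
    && (((padovan_shifted (t + 336) - padovan_shifted t) mod 7 ^ 3 =? 0)%Z == false))
    unit_indices by vm_compute.
  move: h0 h1 => /Z.eqb_neq h0 /Z.eqb_neq h1.
  case=> -> /(proj2 (Z.mod_divide _ _ _)) h; [apply: h0|apply: h1]; exact: h.
elim: k => [|[|k] IHk]; [by apply: base; left|by apply: base; right|].
set D := (_ - _)%Z in IHk; move=> [w Hw]; apply: IHk.
have c0 : (7 ^ Z.of_nat k.+2 <> 0)%Z by apply: Z.pow_nonzero; lia.
have [u] := period_second_order c0 (padovan_like_period7 k.+1)
  padovan_shifted_like z 7.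
rewrite mulnCA -expnS Hw -/D => Hu.
exists (w - u * 7 ^ Z.of_nat k)%Z.
apply: (Z.mul_reg_l _ _ 7) => //.
move: Hu; rewrite !pow7S => Hu.
have -> : (7 * D = w * (7 * (7 * (7 * (7 * 7 ^ Z.of_nat k))))
   - (w * (7 * (7 * (7 * (7 * 7 ^ Z.of_nat k)))) - 7 * D))%Z by ring.
by rewrite Hu; ring.
Qed.

Lemma prime_7 : Znumtheory.prime 7.
Proof.
apply: prime_intro => // r Hr; apply/Zgcd_1_rel_prime.
have : (r = 1 \/ r = 2 \/ r = 3 \/ r = 4 \/ r = 5 \/ r = 6)%Z by lia.
by do 5?[case=> [->//|]]; move=> ->.
Qed.

(** For j = 7 ^ q * i the difference is, to second order, i times the one for j = 7 ^ q, whose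
    7-adic valuation is exactly q + 1; an extra factor 7 must therefore divide i. *)
Lemma padovan_shifted_lift (q z j : nat) : z \in unit_indices ->
  (7 ^ Z.of_nat q.+1 |
   padovan_shifted (z + 48 * j)%N - padovan_shifted z)%Z ->
  7 ^ q %| j.
Proof.
move=> zI; elim: q => [|q IHq] dvd_j; first by rewrite dvd1n.
have /dvdnP[i ij] : 7 ^ q %| j.
  by apply: IHq; apply: Z.divide_trans dvd_j; rewrite [X in (_ | X)%Z]pow7S;
    exists 7%Z.
have c0 : (7 ^ Z.of_nat q.+1 <> 0)%Z by apply: Z.pow_nonzero; lia.
have [u] := period_second_order c0 (padovan_like_period7 q)
  padovan_shifted_like z i.
rewrite mulnCA -ij; case: dvd_j => w -> Hu.
have [d Hd] := padovan_like_period7 q padovan_shifted_like z.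
have nd : ~ (7 | d)%Z.
  move=> [e He]; apply: (padovan_shifted_valuation zI (k := q)).
  by exists e; rewrite Hd He [in RHS]pow7S; ring.
have /(prime_mult _ prime_7)[[v Hv]|//] : (7 | Z.of_nat i * d)%Z.
  exists (w - u * 7 ^ Z.of_nat q)%Z; apply: (Z.mul_reg_r _ _ _ c0).
  move: Hu; rewrite Hd !pow7S => Hu.
  set c := (7 ^ Z.of_nat q)%Z in Hu *.
  have -> : (Z.of_nat i * d * (7 * c) = w * (7 * (7 * c))
    - (w * (7 * (7 * c)) - Z.of_nat i * (d * (7 * c))))%Z by ring.
  by rewrite Hu; ring.
rewrite ij expnS dvdn_pmul2r ?expn_gt0 //.
by apply/dvdnP; exists (Z.to_nat v); lia.
Qed.

Lemma padovan_shifted_gap (q i : nat) : 28 < i ->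
  (7 ^ Z.of_nat q.+1 | padovan_shifted i * padovan_shifted i - 1)%Z ->
  (35 | padovan_shifted i * padovan_shifted i - 1)%Z ->
  48 * 7 ^ q <= i.
Proof.
move=> i28 dvd7 /padovan_shifted_sieve zI.
have iE := divn_eq i 48; rewrite addnC mulnC in iE.
set z := i %% 48 in zI iE; set j := i %/ 48 in iE.
have /orP sq : (padovan_shifted z =? 1)%Z || (padovan_shifted z =? -1)%Z.
  by move: z zI {iE}; apply/allP; vm_compute.
have [w Hw] := period_mul (padovan_like_period35 padovan_shifted_like) z j.
rewrite mulnC -iE in Hw.
have : 7 ^ q %| j.
  apply: (padovan_shifted_lift zI); rewrite -iE.
  (* Modulo 7 the sum is 2 P_z = 2 or -2, so the whole power of 7 falls on the difference. *)
  have cop : rel_prime (7 ^ Z.of_nat q.+1)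
     (padovan_shifted i + padovan_shifted z).
    apply/rel_prime_sym/rel_prime_Zpower_r; first by lia.
    apply/rel_prime_sym/prime_rel_prime; first exact: prime_7.
    by move=> [v Hv]; case: sq => /Z.eqb_eq e; rewrite e in Hv Hw; lia.
  apply: Gauss cop.
  rewrite (_ : (_ + _) * (_ - _) = padovan_shifted i * padovan_shifted i - 1)%Z //.
  by case: sq => /Z.eqb_eq ->; ring.
(* Since z <= 28 < i, the quotient j is positive, and divisibility bounds it from below. *)
have z28 : z <= 28 by move: z zI {iE sq Hw}; apply/allP.
move=> /dvdn_leq; have j0 : 0 < j by lia.
by move=> /(_ j0); lia.
Qed.

(** * Growth bounds *)

Lemma padovanS (m : nat) : padovan m.+3 = padovan m.+1 + padovan m.
Proof. by []. Qed.

Lemma leq_padovanS (m : nat) : padovan m <= padovan m.+1.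
Proof.
elim/ltn_ind: m => -[|[|[|m]]] // IH; rewrite !padovanS.
by rewrite leq_add //; apply: IH; lia.
Qed.

Lemma padovan_exp_lb (m : nat) : 2 ^ (m %/ 3) <= padovan m.
Proof.
have step l : 2 * padovan l <= padovan l.+3.
  by rewrite padovanS mul2n -addnn leq_add2r leq_padovanS.
elim/ltn_ind: m => -[|[|[|m]]] // IH.
have -> : m.+3 %/ 3 = (m %/ 3).+1 by lia.
rewrite expnS; apply: leq_trans (step m); rewrite leq_mul2l /=; apply: IH; lia.
Qed.

Lemma fact_ltn_exp_sq (n : nat) : 0 < n -> n`! < 2 ^ (n * n).
Proof.
elim: n => // -[|n] // IH _; rewrite factS.
apply: leq_trans (_ : 2 ^ n.+2 * 2 ^ (n.+1 * n.+1) <= _); last first.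
  by rewrite -expnD leq_exp2l //; lia.
by apply: ltn_mul; [exact: ltn_expl | exact: IH].
Qed.

Lemma padovan_index_bound (n m : nat) :
  0 < n -> n`! + 1 = padovan m ^ 2 -> 2 * (m %/ 3) <= n * n.
Proof.
move=> n0 e; rewrite mulnC -(leq_exp2l (m := 2)) // expnM.
apply: leq_trans (_ : padovan m ^ 2 <= _).
  by rewrite leq_exp2r // padovan_exp_lb.
by rewrite -e addn1 fact_ltn_exp_sq.
Qed.

(** This keeps only the first term of Legendre's formula. *)
Lemma exp_dvd_fact (p n : nat) : prime p -> p ^ (n %/ p) %| n`!.
Proof.
move=> p_pr; rewrite pfactor_dvdn ?fact_gt0 // logn_fact //.
by case: n => [|n]; rewrite ?div0n // big_ltn // expn1 leq_addr.
Qed.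

(** With q = n / 7 and n <= 7 q + 6, this contradicts 48 * 7 ^ (q - 1) <= 26 + m and 2 m <= 3 n ^ 2
    + 4. It fails at q = 2, whence the threshold n >= 21. *)
Lemma exp7_gt (q : nat) : 2 < q ->
  3 * ((7 * q + 6) * (7 * q + 6)) + 56 < 96 * 7 ^ q.-1.
Proof.
case: q => // q; rewrite [q.+1.-1]/=; elim: q => // -[|[|q]] // IH _.
have := IH isT; rewrite [7 ^ q.+3]expnS; nia.
Qed.

(** * Finite check and conclusion *)

(** Binary integers keep the evaluation of factorials up to 20! feasible. *)
Fixpoint Zfact (n : nat) : Z :=
  if n is n'.+1 then (Z.of_nat n * Zfact n')%Z else 1%Z.

Lemma ZfactE (n : nat) : Zfact n = Z.of_nat n`!.
Proof. by elim: n => // n IH; rewrite factS Nat2Z.inj_mul -IH. Qed.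

Lemma small_solutions (n m : nat) :
  n < 21 -> n`! + 1 = padovan m ^ 2 -> n = 4.
Proof.
move=> n21 e; case: (posnP n) => [n0|n0].
  by move: e; rewrite n0 fact0 -mulnn; case: (padovan m) => [|[|x]] //; nia.
(* From n <= 20 follows m / 3 <= 200. *)
have m603 : m < 603 by have := padovan_index_bound n0 e; nia.
have check : all (fun i => let v := padovan_shifted (26 + i) in let w := (v * v)%Z in
   all (fun k => (Zfact k + 1 =? w)%Z ==> (k == 4)) (iota 0 21)) (iota 0 603).
  by vm_compute.
move/allP/(_ m): check; rewrite mem_iota m603 => /(_ isT) /allP/(_ n).
rewrite mem_iota n21 => /(_ isT)/implyP h; apply/eqP/h/Z.eqb_eq.
by rewrite padovan_shiftedE ZfactE; move: e; rewrite -mulnn; lia.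
Qed.

Lemma solution_bound (n m : nat) : n`! + 1 = padovan m ^ 2 -> n < 21.
Proof.
move=> e; rewrite ltnNge; apply/negP=> n21.
have n0 : 0 < n by apply: leq_trans n21.
have m_ub := padovan_index_bound n0 e.
(* The values P_0 = P_1 = P_2 = 1 would force n! = 0; hence 26 + m > 28. *)
have m3 : 2 < m.
  by case: m e {m_ub} => [|[|[|m]]] //=; have := fact_gt0 n; lia.
have sqE : (padovan_shifted (26 + m) * padovan_shifted (26 + m) - 1
    = Z.of_nat n`!)%Z.
  by rewrite padovan_shiftedE; move: e; rewrite -mulnn; lia.
have dvdZ d : d %| n`! -> (Z.of_nat d |
    padovan_shifted (26 + m) * padovan_shifted (26 + m) - 1)%Z.
  by rewrite sqE => /dvdnP[u ->]; exists (Z.of_nat u); rewrite Nat2Z.inj_mul.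
have d35 : 35 %| n`!.
  by rewrite (@Gauss_dvd 5 7) // !dvdn_fact // (leq_trans _ n21).
have q3 : 2 < n %/ 7 by rewrite leq_divRL.
have q1 : (n %/ 7).-1.+1 = n %/ 7 by rewrite prednK // (leq_trans _ q3).
have pow7 k : Z.of_nat (7 ^ k) = (7 ^ Z.of_nat k)%Z.
  by elim: k => // k IH; rewrite expnS pow7S Nat2Z.inj_mul IH.
have gap : 48 * 7 ^ (n %/ 7).-1 <= 26 + m.
  apply: padovan_shifted_gap; [by lia | | exact: (dvdZ 35)].
  by rewrite q1 -pow7; apply: dvdZ; apply: exp_dvd_fact.
have := exp7_gt q3.
have n_ub : n <= 7 * (n %/ 7) + 6 by lia.
have := leq_mul n_ub n_ub; move: gap m_ub {q1 n_ub}; lia.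
Qed.

Theorem theorem1 (n x : nat) :
  (exists m : nat, x = padovan m) /\ n`! + 1 = x ^ 2 <-> (n, x) = (4, 5).
Proof.
split=> [[[m ->] e]|[-> ->]]; last by split; first by exists 7.
have n4 := small_solutions (solution_bound e) e.
rewrite n4 in e *; congr (_, _).
by apply/eqP; rewrite -(@eqn_exp2r _ _ 2) // -e.
Qed.
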